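(* Let $\mathsf R$ be an ordered ring, $\mathsf C=\mathsf R(\mathrm i)$, and let $\mathcal A$ be a $^*$-algebra over $\mathsf C$ with an approximate identity. Then the following conditions are equivalent: (i) $\mathcal A$ has sufficiently many positive linear functionals. (ii) For any non-zero Hermitian element $H\in\mathcal A$ there exists a $^*$-representation $\pi$ of $\mathcal A$ (on a pre-Hilbert space over $\mathsf C$) with $\pi(H)\neq 0$. (iii) There exists a faithful (i.e. injective) $^*$-representation of $\mathcal A$ on a pre-Hilbert space over $\mathsf C$. If these conditions hold, then the following properties are also fulfilled: (iv) If $A\in\mathcal A$ satisfies $A^*A=0$ then $A=0$. (v) There are no non-zero nilpotent normal elements in $\mathcal A$. (vi) $\mathcal A$ is torsion-free, i.e. $zA=0$ with $0\neq z\in\mathsf C$ and $A\in\mathcal A$ implies $A=0$.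
   Context: An ordered ring is a commutative associative ring $\mathsf R$ with $1\neq0$ and a subset $\mathsf P$ of positive elements such that $\mathsf R$ is the disjoint union $-\mathsf P\cup\{0\}\cup\mathsf P$ and $\mathsf P$ is closed under addition and multiplication; $a\ge b$ means $a-b\in\mathsf P\cup\{0\}$. $\mathsf C=\mathsf R(\mathrm i)=\mathsf R\oplus\mathrm i\mathsf R$ with $\mathrm i^2=-1$ and complex conjugation $\overline{a+\mathrm i b}=a-\mathrm i b$. A $^*$-algebra over $\mathsf C$ is an associative (not necessarily unital) $\mathsf C$-algebra with an antilinear involutive map $^*$ satisfying $(AB)^*=B^*A^*$. $H$ is Hermitian if $H^*=H$; $A$ is normal if $A^*A=AA^*$. A linear functional $\omega:\mathcal A\to\mathsf C$ is positive if $\omega(A^*A)\ge0$ for all $A$. $\mathcal A$ has sufficiently many positive linear functionals if for every non-zero Hermitian $H\in\mathcal A$ there is a positive linear functional $\omega$ with $\omega(H)\neq0$. A pre-Hilbert space over $\mathsf C$ is a $\mathsf C$-module $\mathfrak H$ with a map $\langle\cdot,\cdot\rangle:\mathfrak H\times\mathfrak H\to\mathsf C$, linear in the second argument, with $\overline{\langle\phi,\psi\rangle}=\langle\psi,\phi\rangle$, $\langle\phi,\phi\rangle\ge0$, and $\langle\phi,\phi\rangle=0\Rightarrow\phi=0$. $\mathfrak B(\mathfrak H)$ is the $^*$-algebra of $\mathsf C$-linear endomorphisms of $\mathfrak H$ having an adjoint. A $^*$-representation of $\mathcal A$ on $\mathfrak H$ is a $^*$-homomorphism $\pi:\mathcal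 A\to\mathfrak B(\mathfrak H)$. An approximate identity of $\mathcal A$ is a family $\{\mathcal A_\alpha,E_\alpha\}_{\alpha\in I}$ indexed by a directed set $I$ with $E_\alpha=E_\alpha^*\in\mathcal A$, $E_\alpha=E_\alpha E_\beta=E_\beta E_\alpha$ for $\alpha<\beta$, and submodules $\mathcal A_\alpha\subseteq\mathcal A_\beta$ for $\alpha\le\beta$ with $\mathcal A=\bigcup_\alpha\mathcal A_\alpha$ and $E_\alpha A=A=AE_\alpha$ for all $A\in\mathcal A_\alpha$. *)

(* Defs.v *)
From HB Require Import structures.
From mathcomp Require Import all_boot all_order all_algebra.
From mathcomp Require Import boolp classical_sets functions.
From mathcomp Require Import complex.

Set Implicit Arguments.
Unset Strict Implicit.
Unset Printing Implicit Defensive.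

Import Order.TTheory GRing.Theory Num.Theory.
Local Open Scope ring_scope.

(* real_closed endows R[i] with a ring structure only when R is a field; the
   alias [cplx R] carries the same operations over any commutative ring. *)
Definition cplx (R : comNzRingType) : Type := complex R.

Section ComplexRing.
Variable R : comNzRingType.

HB.instance Definition _ := GRing.Zmodule.copy (cplx R) (complex R).

Definition cplx_mul : cplx R -> cplx R -> cplx R := @ComplexField.mulc R.
Definition cplx_one : cplx R := Complex 1 0.

Fact cplx_mul1 : left_id cplx_one cplx_mul.
Proof. by case=> a b; congr Complex; rewrite !mul1r !mul0r ?subr0 ?addr0. Qed.

Fact cplx_mulDl : left_distributive cplx_mul +%R.
Proof.
case=> [a b] [c d] [e f]; congr Complex; rewrite !mulrDl ?opprD; exact: addrACA.
Qed.

Fact cplx_one_neq0 : cplx_one != 0.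
Proof. by apply/eqP => -[] /eqP; rewrite oner_eq0. Qed.

HB.instance Definition _ := GRing.Zmodule_isComNzRing.Build (cplx R)
  (@ComplexField.mulcA R) (@ComplexField.mulcC R) cplx_mul1 cplx_mulDl
  cplx_one_neq0.

End ComplexRing.

(* z >= 0 means that z is an element of R and is nonnegative there. *)
Definition cplx_ge0 (R : realDomainType) (z : cplx R) : bool :=
  (complex.Im z == 0) && (0 <= complex.Re z).

(* The product of a star-algebra, which need not have a unit, is that of
   semigroupType and is written (a * b)%g. *)
HB.mixin Record LmoduleSemigroup_isStarAlgebra (R : realDomainType) A
    of GRing.Lmodule (cplx R) A & Semigroup A := {
  star : A -> A;
  smulDl : forall a b c : A, (((a + b)%R * c)%g = (a * c)%g + (b * c)%g)%R;
  smulDr : forall a b c : A, ((a * (b + c)%R)%g = (a * b)%g + (a * c)%g)%R;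
  sscaleAl : forall (z : cplx R) (a b : A), ((z *: a) * b)%g = z *: (a * b)%g;
  sscaleAr : forall (z : cplx R) (a b : A), (a * (z *: b))%g = z *: (a * b)%g;
  starD : forall a b : A, star (a + b) = star a + star b;
  starZ : forall (z : cplx R) (a : A), star (z *: a) = (conjc z : cplx R) *: star a;
  starK : involutive star;
  starM : forall a b : A, star (a * b)%g = (star b * star a)%g
}.

#[short(type="starAlgType")]
HB.structure Definition StarAlgebra (R : realDomainType) :=
  {A of LmoduleSemigroup_isStarAlgebra R A & GRing.Lmodule (cplx R) A
      & Semigroup A}.

HB.mixin Record Lmodule_isPreHilbert (R : realDomainType) K
    of GRing.Lmodule (cplx R) K := {
  inner : K -> K -> cplx R;
  inner_scalar : forall x : K, scalar (inner x);
  inner_conj : forall x y : K, conjc (inner x y) = inner y x;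
  inner_ge0 : forall x : K, cplx_ge0 (inner x x);
  inner_eq0 : forall x : K, inner x x = 0 -> x = 0
}.

#[short(type="preHilbertType")]
HB.structure Definition PreHilbert (R : realDomainType) :=
  {K of Lmodule_isPreHilbert R K & GRing.Lmodule (cplx R) K}.

Section StarAlgebraNotions.
Variables (R : realDomainType) (A : starAlgType R).
Implicit Types a : A.

Definition is_hermitian a := star a = a.

Definition is_normal a := (star a * a)%g = (a * star a)%g.

(* [iter n ( *%g a) a] is the (n+1)-st power of [a]; there is no 0-th power. *)
Definition is_nilpotent a := exists n : nat, iter n (fun b => (a * b)%g) a = 0.

Definition positive_functional (omega : {scalar A}) :=
  forall a, cplx_ge0 (omega (star a * a)%g).

Definition sufficiently_many_positive_functionals :=
  forall h : A, is_hermitian h -> h <> 0 ->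
    exists2 omega : {scalar A}, positive_functional omega & omega h <> 0.

(* [i < j] in a preorder means [i <= j] and not [j <= i]; this is the weakest
   reading of the condition, and i <> j with i <= j when I is an order. *)
Record approximate_identity (d : Order.disp_t) (I : preorderType d)
    (S : I -> {pred A}) (E : I -> A) : Prop := ApproximateIdentity {
  appr_inhabited : inhabited I;
  appr_directed : forall i j : I, exists2 k : I, (i <= k)%O & (j <= k)%O;
  appr_hermitian : forall i, is_hermitian (E i);
  appr_mul : forall i j : I, (i < j)%O ->
    E i = (E i * E j)%g /\ E i = (E j * E i)%g;
  appr_submod : forall i, submod_closed (S i);
  appr_mono : forall i j : I, (i <= j)%O -> {subset S i <= S j};
  appr_cover : forall a, exists i, a \in S i;
  appr_unit : forall i, {in S i, forall a, (E i * a)%g = a /\ (a * E i)%g = a}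
}.

End StarAlgebraNotions.

Definition star_morphism (R : realDomainType) (A B : starAlgType R)
    (f : A -> B) : Prop :=
  [/\ linear f, {morph f : a b / (a * b)%g} & {morph f : a / star a}].

Section Adjointable.
Variables (R : realDomainType) (K : preHilbertType R).
Implicit Types (f g : K -> K) (x y : K).

Definition is_adjoint f g := forall x y, inner (g x) y = inner x (f y).

Definition adjointable : {pred K -> K} :=
  fun f => `[< linear f /\ exists g, is_adjoint f g >].

Lemma innerBr x y z : inner x (y - z) = inner x y - inner x z.
Proof. by rewrite -scaleN1r addrC inner_scalar mulN1r addrC. Qed.

Lemma inner_inj x y : (forall z, inner z x = inner z y) -> x = y.
Proof.
by move=> xy; apply/subr0_eq/inner_eq0; rewrite innerBr xy subrr.
Qed.

Lemma conjcK_cplx : involutive (@conjc R).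
Proof. by case=> a b; rewrite /= opprK. Qed.

Lemma inner_conjC x y : inner x y = conjc (inner y x).
Proof. by rewrite inner_conj. Qed.

Lemma is_adjoint_sym f g : is_adjoint f g -> is_adjoint g f.
Proof. by move=> fg x y; rewrite inner_conjC -fg -inner_conjC. Qed.

Lemma is_adjoint_uniq f g g' : is_adjoint f g -> is_adjoint f g' -> g = g'.
Proof.
move=> fg fg'; apply/funext => x; apply: inner_inj => z.
by rewrite inner_conjC [RHS]inner_conjC fg fg'.
Qed.

Lemma conjcD_cplx (z w : cplx R) :
  (conjc (z + w)%R : cplx R) = (conjc z : cplx R) + (conjc w : cplx R).
Proof. by case: z w => [a b] [c d]; congr Complex; rewrite opprD. Qed.

Lemma conjcM_cplx (z w : cplx R) :
  (conjc (z * w)%R : cplx R) = (conjc z : cplx R) * (conjc w : cplx R).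
Proof.
by case: z w => [a b] [c d]; congr Complex; rewrite ?mulrNN // mulrN mulNr opprD.
Qed.

Lemma inner_scalarl (z : cplx R) x y w :
  inner (z *: x + y) w = (conjc z : cplx R) * inner x w + inner y w.
Proof.
rewrite inner_conjC inner_scalar conjcD_cplx conjcM_cplx.
by rewrite -!inner_conjC.
Qed.

Lemma is_adjoint_linear f g : is_adjoint f g -> linear g.
Proof.
move=> fg z x y; apply: inner_inj => w.
by rewrite inner_scalar -!(is_adjoint_sym fg) inner_scalar.
Qed.

Lemma is_adjointP (z : cplx R) f1 g1 f2 g2 :
  is_adjoint f1 g1 -> is_adjoint f2 g2 ->
  is_adjoint (z *: f1 + f2) ((conjc z : cplx R) *: g1 + g2).
Proof.
move=> h1 h2 x y.
by rewrite inner_scalarl conjcK_cplx inner_scalar h1 h2.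
Qed.

Lemma is_adjoint_comp f1 g1 f2 g2 :
  is_adjoint f1 g1 -> is_adjoint f2 g2 -> is_adjoint (f1 \o f2) (g2 \o g1).
Proof. by move=> h1 h2 x y /=; rewrite h2 h1. Qed.

Fact adjointable_submod : submod_closed adjointable.
Proof.
split.
  apply/asboolP; split; first by move=> z x y; rewrite scaler0 addr0.
  exists 0 => x y; have -> : inner x ((0 : K -> K) y) = 0.
    by rewrite -[(0 : K -> K) y](subrr x) innerBr subrr.
  rewrite inner_conjC -[(0 : K -> K) x](subrr y) innerBr subrr.
  by congr Complex; rewrite oppr0.
move=> z f1 f2 /asboolP[l1 [g1 a1]] /asboolP[l2 [g2 a2]].
apply/asboolP; split; last by exists ((conjc z : cplx R) *: g1 + g2);
  exact: is_adjointP.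
by have /is_adjoint_sym/is_adjoint_linear := is_adjointP z a1 a2.
Qed.

HB.instance Definition _ :=
  GRing.isSubmodClosed.Build _ _ adjointable adjointable_submod.

End Adjointable.

Arguments adjointable {R} K.

Section BoundedOperators.
Variables (R : realDomainType) (K : preHilbertType R).

Record bop := Bop { bop_fun :> K -> K; bop_subproof : bop_fun \in adjointable K }.

HB.instance Definition _ := [isSub for bop_fun].
HB.instance Definition _ := [Choice of bop by <:].
HB.instance Definition _ := [SubChoice_isSubLmodule of bop by <:].

Implicit Types T U V : bop.

Lemma bop_linear T : linear T.
Proof. by case: T => f /= /asboolP[]. Qed.

Lemma bop_has_adjoint T : exists g, is_adjoint T g.
Proof. by case: T => f /= /asboolP[]. Qed.

Definition adj_fun T : K -> K := projT1 (cid (bop_has_adjoint T)).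

Lemma adj_funP T : is_adjoint T (adj_fun T).
Proof. by rewrite /adj_fun; case: cid. Qed.

Fact adj_subproof T : adj_fun T \in adjointable K.
Proof.
apply/asboolP; split; first exact: is_adjoint_linear (adj_funP T).
by exists T; apply/is_adjoint_sym/adj_funP.
Qed.

Definition bop_adj T := Bop (adj_subproof T).

Fact comp_subproof T U : (T \o U : K -> K) \in adjointable K.
Proof.
apply/asboolP; split; first by move=> z x y; rewrite /= !bop_linear.
by exists (adj_fun U \o adj_fun T); apply: is_adjoint_comp; apply: adj_funP.
Qed.

Definition bop_comp T U := Bop (comp_subproof T U).

Lemma bop_eq T U : T =1 U -> T = U.
Proof. by move=> TU; apply/val_inj/funext. Qed.

Lemma bop_adj_eq T U : is_adjoint T U -> bop_adj T = U.
Proof. by move=> TU; apply/val_inj/(is_adjoint_uniq (adj_funP T) TU). Qed.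

Fact bop_compA : associative bop_comp.
Proof. by move=> T U V; apply: bop_eq. Qed.

HB.instance Definition _ := isSemigroup.Build bop bop_compA.

Fact bop_compDl T U V : ((T + U)%R * V)%g = ((T * V)%g + (U * V)%g)%R.
Proof. by apply: bop_eq. Qed.

Fact bop_compDr T U V : (T * (U + V)%R)%g = ((T * U)%g + (T * V)%g)%R.
Proof.
apply: bop_eq => x /=.
by have := bop_linear T 1 (U x) (V x); rewrite !scale1r.
Qed.

Fact bop_scaleAl (z : cplx R) T U : ((z *: T) * U)%g = z *: (T * U)%g.
Proof. by apply: bop_eq. Qed.

Fact bop_scaleAr (z : cplx R) T U : (T * (z *: U))%g = z *: (T * U)%g.
Proof.
have T0 : T 0 = 0.
  by have := bop_linear T (-1) 0 0; rewrite !scaleN1r !addNr.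
apply: bop_eq => x /=.
by have := bop_linear T z (U x) 0; rewrite T0 !addr0.
Qed.

Fact bop_adj_lin (z : cplx R) T U :
  bop_adj (z *: T + U) = (conjc z : cplx R) *: bop_adj T + bop_adj U.
Proof. by apply: bop_adj_eq; apply: is_adjointP; apply: adj_funP. Qed.

Fact bop_adjD T U : bop_adj (T + U) = bop_adj T + bop_adj U.
Proof.
rewrite -{1}[T]scale1r bop_adj_lin -[in RHS](scale1r (bop_adj T)).
by congr (_ *: _ + _); congr Complex; rewrite oppr0.
Qed.

Fact bop_adjZ (z : cplx R) T :
  bop_adj (z *: T) = (conjc z : cplx R) *: bop_adj T.
Proof.
have adj0 : bop_adj 0 = 0.
  by apply: (@addrI _ (bop_adj 0)); rewrite -bop_adjD !addr0.
by rewrite -[z *: T]addr0 bop_adj_lin adj0 addr0.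
Qed.

Fact bop_adjK : involutive bop_adj.
Proof. by move=> T; apply/bop_adj_eq/is_adjoint_sym/adj_funP. Qed.

Fact bop_adjM T U : bop_adj (T * U)%g = (bop_adj U * bop_adj T)%g.
Proof. by apply: bop_adj_eq; apply: is_adjoint_comp; apply: adj_funP. Qed.

HB.instance Definition _ := LmoduleSemigroup_isStarAlgebra.Build R bop
  bop_compDl bop_compDr bop_scaleAl bop_scaleAr
  bop_adjD bop_adjZ bop_adjK bop_adjM.

End BoundedOperators.

Definition star_representation (R : realDomainType) (A : starAlgType R)
    (K : preHilbertType R) (pi : A -> bop K) : Prop := star_morphism pi.

(* Main.v *)
(* A positive functional w yields a positive semidefinite form w(a^* b), and the
   direct sum of the corresponding GNS representations kills a only if
   w(c^* a b) = 0 for all w, b, c.  Choosing c = a and b = E_i with a E_i = a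
   gives w(a^* a) = 0, hence w(a) = w(E_i a) = 0 by Cauchy-Schwarz, for every
   positive w.  Sufficiently many positive functionals then force a = 0: since
   w(a^* ) is the conjugate of w(a), they kill i (a - a^* ), so that a is
   Hermitian, and then they kill a.  This avoids dividing by 2.  Conversely, vector
   functionals separate Hermitian elements by polarization. *)
Require Import Defs.
From HB Require Import structures.
From mathcomp Require Import all_boot all_order all_algebra.
From mathcomp Require Import boolp classical_sets functions complex ring lra.
Set Implicit Arguments.
Unset Strict Implicit.
Unset Printing Implicit Defensive.
Import Order.TTheory GRing.Theory Num.Theory.
Local Open Scope ring_scope.

(** * Conjugation, positivity and zero divisors in [cplx R] *)

Section ComplexOrder.
Variable R : realDomainType.
Implicit Types z w : cplx R.

Definition conj_cplx z : cplx R := conjc z.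

Definition cplx_i : cplx R := Complex 0 1.

Lemma conj_cplxD z w : conj_cplx (z + w) = conj_cplx z + conj_cplx w.
Proof. exact: conjcD_cplx. Qed.

Lemma conj_cplx0 : conj_cplx 0 = 0.
Proof. by congr Complex; rewrite oppr0. Qed.

Lemma conj_cplx_sum (J : Type) (r : seq J) (F : J -> cplx R) :
  conj_cplx (\sum_(j <- r) F j) = \sum_(j <- r) conj_cplx (F j).
Proof. exact: (big_morph _ conj_cplxD conj_cplx0). Qed.

(** Multiplying by the conjugate of [z] replaces [z] by [a ^+ 2 + b ^+ 2], a non-zero element of
    [R], which can be cancelled in each coordinate. *)
Lemma cplx_mulf_eq0 z w : z <> 0 -> z * w = 0 -> w = 0.
Proof.
case: z w => [a b] [c d] nz0 [e1 e2].
have ab0 : a ^+ 2 + b ^+ 2 != 0.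
  rewrite paddr_eq0 ?sqr_ge0 // !sqrf_eq0.
  by apply/negP => /andP[/eqP a0 /eqP b0]; apply: nz0; rewrite a0 b0.
congr Complex; apply: (mulfI ab0).
  rewrite mulr0 (_ : _ * _ = a * (a * c - b * d) + b * (a * d + b * c)).
    by rewrite e1 e2 !mulr0 addr0.
  by ring.
rewrite mulr0 (_ : _ * _ = a * (a * d + b * c) - b * (a * c - b * d)).
  by rewrite e1 e2 !mulr0 subr0.
by ring.
Qed.

Lemma cplx_ge0D z w : cplx_ge0 z -> cplx_ge0 w -> cplx_ge0 (z + w).
Proof.
case: z w => [a b] [c d] /andP[/= /eqP-> a0] /andP[/= /eqP-> c0].
by rewrite /cplx_ge0 /= addr0 eqxx addr_ge0.
Qed.

Lemma cplx_ge0_sum_eq0 (J : eqType) (r : seq J) (F : J -> cplx R) :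
    (forall j, cplx_ge0 (F j)) -> \sum_(j <- r) F j = 0 ->
  {in r, forall j, F j = 0}.
Proof.
move=> F0; elim: r => [|k r IHr] // /[!big_cons] s0 j.
have sr0 : cplx_ge0 (\sum_(i <- r) F i).
  by elim: r {IHr s0} => [|i r]; [rewrite big_nil /cplx_ge0 /= eqxx lexx
    | rewrite big_cons; apply: cplx_ge0D].
have Fk0 : F k = 0.
  move: s0 sr0 (F0 k); case: (F k) (\sum_(i <- r) F i) => [a b] [c d].
  move=> [ac bd] /andP[/= /eqP d0 c0] /andP[/= /eqP b0 a0].
  congr Complex => //; lra.
rewrite inE => /predU1P[-> //|]; apply: IHr.
by rewrite Fk0 add0r in s0.
Qed.

End ComplexOrder.

(** * Positive functionals and the elements they annihilate *)

Section StarAlgebra.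
Variables (R : realDomainType) (A : starAlgType R).
Implicit Types (a b c : A) (z : cplx R).

Lemma smul0r a : (a * 0%R)%g = 0.
Proof. by rewrite -(scale0r (0 : A)) sscaleAr !scale0r. Qed.

Lemma starB a b : star (a - b) = star a - star b.
Proof. by apply: (addIr (star b)); rewrite -starD !subrK. Qed.

Section PositiveFunctional.
Variables (w : {scalar A}) (w_ge0 : positive_functional w).

Local Notation s a b := (w (star a * b)%g).

Lemma form_lin z a b c :
  s a (z *: b + c) = z * s a b + s a c.
Proof. by rewrite smulDr sscaleAr linearD scalarZ. Qed.

Lemma form_antilin z a b c :
  s (z *: a + b) c = conj_cplx z * s a c + s b c.
Proof. by rewrite starD starZ smulDl sscaleAl linearD scalarZ. Qed.

Lemma form_linZ z a b : s a (z *: b) = z * s a b.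
Proof. by rewrite sscaleAr scalarZ. Qed.

Lemma form_antilinZ z a b : s (z *: a) b = conj_cplx z * s a b.
Proof. by rewrite starZ sscaleAl scalarZ. Qed.

(** Values on squares are real: [a + b] compares the imaginary parts of [s a b] and [s b a], and
    [i a + b] their real parts. *)
Lemma form_conj a b : conj_cplx (s a b) = s b a.
Proof.
have e1 := w_ge0 (1 *: a + b); have e2 := w_ge0 (cplx_i R *: a + b).
move: e1 e2 (w_ge0 a) (w_ge0 b); rewrite !form_antilin !form_lin.
case: (s a a) (s a b) (s b a) (s b b) => [a1 a2] [b1 b2] [c1 c2] [d1 d2].
rewrite /cplx_ge0 /= => /andP[/eqP e1 _] /andP[/eqP e2 _].
move=> /andP[/eqP e3 _] /andP[/eqP e4 _].
by congr Complex; lra.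
Qed.

(* With [q = |s a b|^2] and [p = s b b], the vector [q b - (p + 1) (s a b) a]
   has square [- q^2 (p + 2)] when [s a a = 0].  The factor [q] replaces a
   division, as [q] may be an infinitesimal without inverse. *)
Lemma form_null a b : s a a = 0 -> s b a = 0.
Proof.
move=> aa0; rewrite -form_conj.
have := form_conj a b; case eab : (s a b) => [x y] /esym eba.
have /andP[] := w_ge0 b; case ebb: (s b b) => [p p'] /= /eqP p'0 p0.
rewrite {}p'0 in ebb.
pose q := x ^+ 2 + y ^+ 2; pose q' : cplx R := Complex q 0.
pose t : cplx R := Complex (- (p + 1) * x) (- (p + 1) * y).
have := w_ge0 (q' *: b + (t *: a + 0)).
rewrite addr0 form_antilin !form_lin !(form_linZ, form_antilinZ).
rewrite aa0 ebb eba eab !mulr0 addr0 => /andP[_ /=].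
set v := (X in 0 <= X) => v0.
have ve : v = - (q ^+ 2 * (p + 2)) by rewrite /v /q; ring.
have q0 : q = 0.
  apply/eqP; rewrite -sqrf_eq0; apply/negP => /negP q0.
  have : 0 < q ^+ 2 * (p + 2).
    by rewrite mulr_gt0 ?exprn_even_gt0 ?ltr_wpDl //= -sqrf_eq0.
  by rewrite ltNge -oppr_ge0 -ve v0.
have /andP[/eqP x0 /eqP y0] : (x == 0) && (y == 0).
  by rewrite -(sqrf_eq0 x) -(sqrf_eq0 y) -paddr_eq0 ?sqr_ge0 // -/q q0.
by congr Complex; rewrite ?x0 ?y0 ?oppr0.
Qed.

End PositiveFunctional.

(** Induction on the exponent: if [a * c = 0] for a power [c] of [a], normality rewrites the square
    of [star a * c] so that [a * c] appears, hence [star a * c = 0], which forces [c = 0]. *)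
Lemma nilpotent_normal_eq0 a :
    (forall b, (star b * b)%g = 0 -> b = 0) ->
  is_normal a -> is_nilpotent a -> a = 0.
Proof.
move=> anis na [n]; elim: n => [|n IHn] //=; set c := iter n _ a => aac.
apply: IHn; rewrite -/c.
have sac : (star a * c)%g = 0.
  apply: anis.
  by rewrite starM starK -mulgA [(a * _)%g]mulgA -na -mulgA aac !smul0r.
(* Either [c] is [a] itself or it has [a] as left factor; in both cases [star c * c] contains
   [star a * c]. *)
apply: anis; rewrite /c in sac *; case: n {c aac} sac => [|n] //= sac.
by rewrite starM -mulgA sac smul0r.
Qed.

Lemma separating_functionals (d : Order.disp_t) (I : preorderType d)
    (S : I -> {pred A}) (E : I -> A) a :
    approximate_identity S E -> sufficiently_many_positive_functionals A ->
  (forall w : {scalar A}, positive_functional w -> w a = 0) -> a = 0.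
Proof.
move=> apprE suff wa0.
(* [E i] replaces the unit: [w (star a * E i)] is the conjugate of [w (E i * a)]. *)
have wherm w : positive_functional w -> w (star a) = 0.
  move=> w0; have [i aS] := appr_cover apprE a.
  have [Ea _] := appr_unit apprE aS.
  rewrite -{1}Ea starM (appr_hermitian apprE) -form_conj //.
  by rewrite (appr_hermitian apprE) Ea wa0 // conj_cplx0.
have hermitian0 h : is_hermitian h ->
    (forall w : {scalar A}, positive_functional w -> w h = 0) -> h = 0.
  move=> hh wh0; apply: contrapT => /(suff _ hh)[w w0]; apply; exact: wh0.
apply: (hermitian0) => //.
have : cplx_i R *: (a - star a) = 0.
  apply: hermitian0.
    rewrite /is_hermitian starZ starB starK -[a - _]opprB scalerN -scaleNr.
    by congr (_ *: _); congr Complex; rewrite /= oppr0.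
  by move=> w w0; rewrite scalarZ linearB wa0 // wherm // subrr mulr0.
(* The scalar [i] has inverse [- i], so it cancels before torsion-freeness is known. *)
move/(congr1 (fun b => (- cplx_i R) *: b)).
rewrite scalerA scaler0 (_ : _ * _ = 1) ?scale1r.
  by move/subr0_eq.
by congr Complex => /=; ring.
Qed.

(** This yields both the injectivity of the GNS representation and property (iv). *)
Lemma positive_functional_faithful (d : Order.disp_t) (I : preorderType d)
    (S : I -> {pred A}) (E : I -> A) a :
    approximate_identity S E -> sufficiently_many_positive_functionals A ->
    (forall w : {scalar A}, positive_functional w -> w (star a * a)%g = 0) ->
  a = 0.
Proof.
move=> apprE suff waa0; apply: (separating_functionals apprE suff) => w w0.
have [i aS] := appr_cover apprE a; have [Ea _] := appr_unit apprE aS.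
by rewrite -Ea -(appr_hermitian apprE) form_null // waa0.
Qed.

End StarAlgebra.

(** * The direct sum of the GNS representations of all positive functionals *)

Section GNS.
Variables (R : realDomainType) (A : starAlgType R).

Record pos_functional := PosFunctional {
  pos_functional_fun :> {scalar A};
  pos_functionalP : positive_functional pos_functional_fun }.

HB.instance Definition _ := gen_eqMixin pos_functional.

Implicit Types (w : pos_functional) (x y : pos_functional -> A)
  (U : seq pos_functional) (a b : A).

(* The GNS spaces of all positive functionals are summed directly.  Instead of
   taking a quotient, the class of a finitely supported family [x] is
   represented by the function [(w, b) |-> w (b^* x_w)], which determines it
   because [w (a^* a) = 0] forces [w (b^* a) = 0] for all [b]. *)
Definition gns_vec x : pos_functional * A -> (cplx R)^o :=
  fun p => p.1 (star p.2 * x p.1)%g.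

(** [U] contains the support of [x], possibly strictly. *)
Definition gns_rep (f : pos_functional * A -> (cplx R)^o) x U :=
  [/\ uniq U, forall w, w \notin U -> x w = 0 & f = gns_vec x].

Definition gns_pred : {pred pos_functional * A -> (cplx R)^o} :=
  fun f => `[< exists x U, gns_rep f x U >].

Lemma gns_vec_lin z x y :
  gns_vec (fun w => z *: x w + y w) = z *: gns_vec x + gns_vec y.
Proof. by apply/funext => -[w b]; rewrite /gns_vec /= form_lin. Qed.

Fact gns_pred_submod : submod_closed gns_pred.
Proof.
split.
  apply/asboolP; exists (fun=> 0), [::]; split=> //.
  by apply/funext => -[w b]; rewrite /gns_vec /= smul0r linear0.
move=> z f g /asboolP[x [U [_ xU ->]]] /asboolP[y [V [_ yV ->]]].
apply/asboolP; exists (fun w => z *: x w + y w), (undup (U ++ V)); split.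
- exact: undup_uniq.
- move=> w; rewrite mem_undup mem_cat negb_or => /andP[/xU-> /yV->].
  by rewrite scaler0 addr0.
- by rewrite gns_vec_lin.
Qed.

HB.instance Definition _ :=
  GRing.isSubmodClosed.Build _ _ gns_pred gns_pred_submod.

Record gns := Gns { gns_fun :> pos_functional * A -> (cplx R)^o;
                    gns_subproof : gns_fun \in gns_pred }.

HB.instance Definition _ := [isSub for gns_fun].
HB.instance Definition _ := [Choice of gns by <:].
HB.instance Definition _ := [SubChoice_isSubLmodule of gns by <:].

Implicit Types f g h : gns.

Lemma gns_has_rep f : exists xU, gns_rep f xU.1 xU.2.
Proof. by have /asboolP[x [U fxU]] := gns_subproof f; exists (x, U). Qed.

(** If [y] represents [g], this is the sum of the [w (star (x w) * y w)]; only [f] needs a chosen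
    representative. *)
Definition gns_inner f g : cplx R :=
  let: (x, U) := projT1 (cid (gns_has_rep f)) in \sum_(w <- U) g (w, x w).

Lemma gns_innerP f : exists x U, gns_rep f x U /\
  forall g, gns_inner f g = \sum_(w <- U) g (w, x w).
Proof.
by rewrite /gns_inner; case: cid => -[x U] /= fxU; exists x, U; split.
Qed.

Lemma gns_conj f g w x y :
    f = gns_vec x :> (_ -> _) -> g = gns_vec y :> (_ -> _) ->
  g (w, x w) = conj_cplx (f (w, y w)).
Proof. by move=> -> ->; rewrite /gns_vec /= form_conj //; case: w. Qed.

Lemma gns_fun0 f x U w b : gns_rep f x U -> w \notin U -> f (w, b) = 0.
Proof.
by case=> _ xU -> /xU x0; rewrite /gns_vec /= x0 smul0r linear0.
Qed.

Lemma big_support (V : nmodType) U1 U2 (F : pos_functional -> V) :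
    uniq U1 -> uniq U2 -> (forall w, w \notin U1 -> F w = 0) ->
    (forall w, w \notin U2 -> F w = 0) ->
  \sum_(w <- U1) F w = \sum_(w <- U2) F w.
Proof.
move=> u1 u2 F1 F2.
have half W1 (W2 : seq pos_functional) : (forall w, w \notin W2 -> F w = 0) ->
    \sum_(w <- W1) F w = \sum_(w <- [seq w <- W1 | w \in W2]) F w.
  by move=> FW; rewrite big_filter [RHS]big_rmcond_in // => w _ /FW.
rewrite (half U1 U2) // (half U2 U1) //; apply: perm_big.
apply: uniq_perm; rewrite ?filter_uniq // => w.
by rewrite !mem_filter andbC.
Qed.

(** Independence of the representative: each term is the conjugate of [f (w, y w)] with [y]
    representing [g], where [x] no longer occurs. *)
Lemma gns_innerE f g x U :
  gns_rep f x U -> gns_inner f g = \sum_(w <- U) g (w, x w).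
Proof.
move=> fxU; have [x' [U' [fx'U' ->]]] := gns_innerP f.
have [y [V [[_ _ gy] _]]] := gns_innerP g.
have [uU _ fx] := fxU; have [uU' _ fx'] := fx'U'.
under eq_bigr do rewrite (gns_conj _ fx' gy).
under [RHS]eq_bigr do rewrite (gns_conj _ fx gy).
rewrite -!conj_cplx_sum; congr conj_cplx; apply: big_support => // w.
  exact: gns_fun0 fx'U'.
exact: gns_fun0 fxU.
Qed.

Fact gns_inner_scalar f : scalar (gns_inner f).
Proof.
move=> z g h; have [x [U [_ fE]]] := gns_innerP f.
by rewrite !fE mulr_sumr -big_split.
Qed.

Fact gns_inner_conj f g : conjc (gns_inner f g) = gns_inner g f.
Proof.
have [x [U [fxU ->]]] := gns_innerP f; have [y [V [gyV ->]]] := gns_innerP g.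
rewrite -/(conj_cplx _) conj_cplx_sum.
have [uU xU fx] := fxU; have [uV yV gy] := gyV.
under eq_bigr do rewrite -(gns_conj _ gy fx).
apply: big_support => // w wU; first exact: gns_fun0 fxU wU.
by rewrite (gns_conj _ gy fx) (gns_fun0 _ gyV wU) conj_cplx0.
Qed.

Fact gns_inner_ge0 f : cplx_ge0 (gns_inner f f).
Proof.
have [x [U [[_ _ fx] ->]]] := gns_innerP f.
apply: (big_ind (@cplx_ge0 R)); first by rewrite /cplx_ge0 eqxx lexx.
  exact: cplx_ge0D.
by move=> w _; rewrite fx; apply: pos_functionalP.
Qed.

Fact gns_inner_eq0 f : gns_inner f f = 0 -> f = 0.
Proof.
have [x [U [[_ xU fx] ->]]] := gns_innerP f; rewrite fx => f0.
apply/val_inj; rewrite /= fx; apply/funext => -[w b]; rewrite /gns_vec /=.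
have [wU|/xU ->] := boolP (w \in U); last by rewrite smul0r linear0.
apply: form_null; first exact: pos_functionalP.
exact: (cplx_ge0_sum_eq0 (fun w => pos_functionalP w (x w)) f0 wU).
Qed.

HB.instance Definition _ := Lmodule_isPreHilbert.Build R gns
  gns_inner_scalar gns_inner_conj gns_inner_ge0 gns_inner_eq0.

(** As [star b * (a * x w) = star (star a * b) * x w], left multiplication by [a] acts on classes by
    precomposition, without choosing representatives. *)
Lemma gns_rep_act a (f : pos_functional * A -> (cplx R)^o) x U :
    gns_rep f x U ->
  gns_rep (fun p => f (p.1, (star a * p.2)%g)) (fun w => (a * x w)%g) U.
Proof.
case=> uU xU fx; split=> //; first by move=> w /xU ->; rewrite smul0r.
by apply/funext => -[w b]; rewrite fx /gns_vec /= starM starK mulgA.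
Qed.

Fact gns_act_subproof a f :
  (fun p : pos_functional * A => f (p.1, (star a * p.2)%g)) \in gns_pred.
Proof.
have [x [U [fxU _]]] := gns_innerP f.
by apply/asboolP; exists (fun w => (a * x w)%g), U; apply: gns_rep_act.
Qed.

Definition gns_act a f : gns := Gns (gns_act_subproof a f).

Lemma gns_act_linear a : linear (gns_act a).
Proof. by move=> z f g; apply/val_inj. Qed.

Lemma gns_act_adjoint a : is_adjoint (gns_act a) (gns_act (star a)).
Proof.
move=> f g; have [x [U [fxU _]]] := gns_innerP f.
rewrite [LHS](@gns_innerE (gns_act _ f) _ _ _ (gns_rep_act (star a) fxU)).
by rewrite [RHS](gns_innerE _ fxU).
Qed.

Fact gns_pi_subproof a : gns_act a \in adjointable gns.
Proof.
apply/asboolP; split; first exact: gns_act_linear.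
by exists (gns_act (star a)); apply: gns_act_adjoint.
Qed.

Definition gns_pi a : bop gns := Bop (gns_pi_subproof a).

Lemma gns_pi_representation : star_representation gns_pi.
Proof.
split.
- move=> z a b; apply: bop_eq => f; apply/val_inj/funext => -[w c] /=.
  have [x [U [[_ _ fx] _]]] := gns_innerP f; rewrite fx /gns_vec /=.
  have wE u : w (star (star u * c) * x w)%g = w (star c * (u * x w))%g.
    by rewrite starM starK mulgA.
  by rewrite wE smulDl sscaleAl form_lin -!wE.
- move=> a b; apply: bop_eq => f; apply/val_inj/funext => -[w c] /=.
  by rewrite starM mulgA.
- by move=> a; apply/esym/bop_adj_eq/gns_act_adjoint.
Qed.

Lemma gns_pi_form_eq0 a b c (w : {scalar A}) : positive_functional w ->
  gns_pi a = 0 -> w (star c * (a * b))%g = 0.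
Proof.
move=> w0 a0; pose v := PosFunctional w0.
(* The class of [b] in the single summand of [v]; its image under [gns_pi a] is then evaluated at
   [(v, c)]. *)
pose x u := if u == v then b else 0.
have xrep : gns_rep (gns_vec x) x [:: v].
  by split=> // u; rewrite inE /x => /negPf ->.
have xin : gns_vec x \in gns_pred by apply/asboolP; exists x, [:: v].
have : gns_pi a (Gns xin) = 0 by rewrite a0.
move/(congr1 (fun f : gns => f (v, c))).
by rewrite /= /gns_vec /= starM starK mulgA /x eqxx.
Qed.

End GNS.

(** * Vector functionals and polarization *)

Section VectorFunctional.
Variables (R : realDomainType) (A : starAlgType R) (K : preHilbertType R).
Variables (pi : A -> bop K) (pi_rep : star_representation pi).

(* The proof argument lets the scalar structure below be inferred. *)
Definition vector_functional (_ : star_representation pi) (phi : K) (a : A) :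
  cplx R := inner phi (pi a phi).

Fact vector_functional_scalar phi : scalar (vector_functional pi_rep phi).
Proof.
move=> z a b; have [pi_lin _ _] := pi_rep.
by rewrite /vector_functional pi_lin inner_scalar.
Qed.

HB.instance Definition _ phi := GRing.isLinear.Build (cplx R) A (cplx R) *%R
  (vector_functional pi_rep phi) (vector_functional_scalar phi).

Lemma vector_functional_ge0 phi :
  positive_functional (vector_functional pi_rep phi).
Proof.
move=> a; have [_ piM piS] := pi_rep.
rewrite /= /vector_functional piM piS /=.
by rewrite -(is_adjoint_sym (adj_funP (pi a))); apply: inner_ge0.
Qed.

End VectorFunctional.

(** Polarization with [y + x] and [i y + x] shows that the sum and the difference of [inner x (T y)]
    and [inner y (T x)] vanish; [R] has no 2-torsion. *)
Lemma bop_eq0 (R : realDomainType) (K : preHilbertType R) (T : bop K) :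
  (forall x, inner x (T x) = 0) -> T = 0.
Proof.
move=> T0; apply: bop_eq => y; apply: inner_inj => x.
have -> : inner x ((0 : bop K) y) = 0.
  by rewrite -[RHS](subrr (inner x y)) -innerBr subrr.
have e1 := T0 (1 *: y + x); have e2 := T0 (cplx_i R *: y + x).
move: e1 e2; rewrite !bop_linear !inner_scalarl !inner_scalar !T0.
case: (inner x (T y)) (inner y (T x)) => [a b] [c d] [e1 e2] [e3 e4].
rewrite /= in e1 e2 e3 e4.
congr Complex; lra.
Qed.

Theorem proposition2p8 (R : realDomainType) (A : starAlgType R)
    (d : Order.disp_t) (I : preorderType d) (S : I -> {pred A}) (E : I -> A)
    (apprE : approximate_identity S E) :
  let cond_i := sufficiently_many_positive_functionals A in
  let cond_ii := forall h : A, is_hermitian h -> h <> 0 ->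
    exists (K : preHilbertType R) (pi : A -> bop K),
      star_representation pi /\ pi h <> 0 in
  let cond_iii := exists (K : preHilbertType R) (pi : A -> bop K),
    star_representation pi /\ injective pi in
  [/\ cond_i <-> cond_ii, cond_ii <-> cond_iii &
    cond_i ->
    [/\ forall a : A, (star a * a)%g = 0 -> a = 0,
        forall a : A, is_normal a -> is_nilpotent a -> a = 0 &
        forall (z : cplx R) (a : A), z <> 0 -> z *: a = 0 -> a = 0]].
Proof.
move=> cond_i cond_ii cond_iii.
have i_iii : cond_i -> cond_iii.
  move=> suff; exists (gns A), (@gns_pi R A).
  have pi_rep := gns_pi_representation A; split=> // a b ab.
  apply: subr0_eq; apply: (positive_functional_faithful apprE suff) => w w0.
  have [i abS] := appr_cover apprE (a - b).
  have [_ abE] := appr_unit apprE abS.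
  (* The right factor [E i] serves as the vector on which the operator of [a - b] acts. *)
  rewrite -{2}abE; apply: gns_pi_form_eq0 => //.
  have [pi_lin _ _] := pi_rep.
  by rewrite addrC -scaleN1r pi_lin scaleN1r ab addNr.
have iii_ii : cond_iii -> cond_ii.
  move=> [K [pi [pi_rep pi_inj]]] h _ h0; exists K, pi; split=> // pih0.
  apply/h0/pi_inj; rewrite pih0; have [pi_lin _ _] := pi_rep.
  by rewrite -(subrr h) addrC -scaleN1r pi_lin scaleN1r addNr.
have ii_i : cond_ii -> cond_i.
  move=> rep h hh h0; have [K [pi [pi_rep pih0]]] := rep h hh h0.
  have [phi phih] : exists phi, inner phi (pi h phi) <> 0.
    apply: contrapT => nophi; apply/pih0/bop_eq0 => x.
    by apply: contrapT => x0; apply: nophi; exists x.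
  exists (vector_functional pi_rep phi) => //; exact: vector_functional_ge0.
split; [by split=> [/i_iii/iii_ii|] | by split=> [/ii_i/i_iii|] |].
move=> suff; have anis (a : A) : (star a * a)%g = 0 -> a = 0.
  move=> a0; apply: (positive_functional_faithful apprE suff) => w _.
  by rewrite a0 linear0.
split=> // [a|z a z0 za0]; first exact: nilpotent_normal_eq0.
(* Torsion is tested on values: [z * w a = w (z *: a) = 0] in [cplx R], which has no zero
   divisors. *)
apply: (separating_functionals apprE suff) => w _.
by apply: (cplx_mulf_eq0 z0); rewrite -scalarZ za0 linear0.
Qed.
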